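(* Let $A:\Omega\times[0,\infty)\to\mathbb R^{n\times n}$, written $A(t,x)$, satisfy the Cauchy initial value problem $$\partial_tA=\Delta A,\qquad A(0,x)=A_0(x).$$ Assume that $\|A_0(x)\|_F=1$ for every $x\in\Omega$. Then $\|A(t,x)\|_F\le1$ for all $t\ge0$ and $x\in\Omega$. This implies that $\|A(t,x)\|_2\le1$ and $A(t,\cdot)\in K_n$ (pointwise in $x$) for $t\ge0$. Furthermore, if $A_0(x)\in O(n)$, then $$|\det A(t,x)|\le1\qquad\text{for all }x\in\Omega,\ t\ge0.$$
   Context: $\Omega$ is a flat torus or, more generally, a closed manifold, and $\Delta$ acts entrywise on matrix-valued functions. $\|\cdot\|_F$ is the Frobenius norm, $\|\cdot\|_2$ the spectral norm (largest singular value), $O(n)$ the group of real orthogonal $n\times n$ matrices, and $K_n=\{A\in\mathbb R^{n\times n}:\|A\|_2\le1\}$ the convex hull of $O(n)$. *)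

(* Defs.v *)
From HB Require Import structures.
From mathcomp Require Import all_boot all_order all_algebra.
From mathcomp Require Import all_classical all_reals all_analysis.

Set Implicit Arguments.
Unset Strict Implicit.
Unset Printing Implicit Defensive.

Import Order.TTheory GRing.Theory Num.Theory.
Import numFieldNormedType.Exports.

Local Open Scope classical_set_scope.
Local Open Scope ring_scope.

Section Calculus.
Variables (R : realType) (d : nat).
Implicit Types (D : set 'rV[R]_d) (F : 'rV[R]_d -> R).

Definition partial (k : 'I_d) F : 'rV[R]_d -> R :=
  fun y => 'D_(delta_mx 0 k) F y.

(* Meant for open D: all partial derivatives of order at most m exist and are
   continuous at every point of D. *)
Fixpoint Ck_on (m : nat) D F : Prop :=
  (forall y, D y -> {for y, continuous F}) /\
  if m is m'.+1 then
    forall k : 'I_d,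
      (forall y, D y -> derivable F y (delta_mx 0 k)) /\
      Ck_on m' D (partial k F)
  else True.

Definition smooth_on D F : Prop := forall m, Ck_on m D F.

End Calculus.

Record chart (R : realType) (d : nat) (M : topologicalType) := Chart {
  chart_dom : set M;
  chart_cod : set 'rV[R]_d;
  chart_map : M -> 'rV[R]_d;
  chart_inv : 'rV[R]_d -> M;
  chart_dom_open : open chart_dom;
  chart_cod_open : open chart_cod;
  chart_map_cod : forall x, chart_dom x -> chart_cod (chart_map x);
  chart_inv_dom : forall y, chart_cod y -> chart_dom (chart_inv y);
  chart_mapK : forall x, chart_dom x -> chart_inv (chart_map x) = x;
  chart_invK : forall y, chart_cod y -> chart_map (chart_inv y) = y;
  chart_map_continuous : {within chart_dom, continuous chart_map};
  chart_inv_continuous : {within chart_cod, continuous chart_inv} }.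

Section Transition.
Variables (R : realType) (d : nat) (M : topologicalType).
Implicit Types c : chart R d M.

Definition overlap c c' : set 'rV[R]_d :=
  [set y | chart_cod c y /\ chart_dom c' (chart_inv c y)].

Definition transition c c' (k : 'I_d) : 'rV[R]_d -> R :=
  fun y => chart_map c' (chart_inv c y) 0 k.

(* Entry (k, l) is the derivative of the k-th component in direction l. *)
Definition jacobian_transition c c' (y : 'rV[R]_d) : 'M[R]_d :=
  \matrix_(k, l) partial l (transition c c' k) y.

End Transition.

(* A compact Hausdorff manifold of dimension d without boundary, with a smooth
   atlas indexed by [atlas_index] (second countability follows from
   compactness); connectedness is not required.  [chart_at] selects, for each
   point, a chart of the atlas around it. *)
Record closedManifold (R : realType) (d : nat) := ClosedManifold {
  carrier :> topologicalType;
  carrier_hausdorff : hausdorff_space carrier;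
  carrier_compact : compact [set: carrier];
  atlas_index : Type;
  atlas : atlas_index -> chart R d carrier;
  chart_at : carrier -> atlas_index;
  chart_at_dom : forall x, chart_dom (atlas (chart_at x)) x;
  transition_smooth : forall (i j : atlas_index) (k : 'I_d),
    smooth_on (overlap (atlas i) (atlas j))
      (transition (atlas i) (atlas j) k) }.

(* The metric tensor in local coordinates: [metric i y] is the matrix
   (g_kl(y)) in the chart i; [metric_transition] is the tensor law. *)
Record riemannianMetric (R : realType) (d : nat) (M : closedManifold R d) :=
  RiemannianMetric {
  metric : atlas_index M -> 'rV[R]_d -> 'M[R]_d;
  metric_smooth : forall i k l,
    smooth_on (chart_cod (atlas i)) (fun y => metric i y k l);
  metric_symmetric : forall i y, chart_cod (atlas i) y ->
    (metric i y)^T = metric i y;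
  metric_posdef : forall i y (v : 'rV[R]_d), chart_cod (atlas i) y ->
    v != 0 -> 0 < (v *m metric i y *m v^T) 0 0;
  metric_transition : forall i j y,
    overlap (atlas i) (atlas j) y ->
    metric i y =
      (jacobian_transition (atlas i) (atlas j) y)^T
      *m metric j (chart_map (atlas j) (chart_inv (atlas i) y))
      *m jacobian_transition (atlas i) (atlas j) y }.

Section Laplacian.
Variables (R : realType) (d : nat) (M : closedManifold R d).
Variable g : riemannianMetric M.

Definition local_rep (i : atlas_index M) (f : M -> R) : 'rV[R]_d -> R :=
  fun y => f (chart_inv (atlas i) y).

Definition Ck_manifold (m : nat) (f : M -> R) : Prop :=
  forall i, Ck_on m (chart_cod (atlas i)) (local_rep i f).

(* Laplace-Beltrami operator in local coordinates, with G = det (g_kl) and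
   (g^kl) the inverse matrix:
     G^(-1/2) sum_k d_k (G^(1/2) sum_l g^kl d_l F). *)
Definition laplacian_in (i : atlas_index M) (F : 'rV[R]_d -> R)
    (y : 'rV[R]_d) : R :=
  (Num.sqrt (\det (metric g i y)))^-1 *
  \sum_(k < d)
    partial k
      (fun z => Num.sqrt (\det (metric g i z)) *
                \sum_(l < d) invmx (metric g i z) k l * partial l F z) y.

(* The value does not depend on the chart around x. *)
Definition laplacian (f : M -> R) (x : M) : R :=
  laplacian_in (chart_at x) (local_rep (chart_at x) f)
    (chart_map (atlas (chart_at x)) x).

Definition laplacian_mx (n : nat) (B : M -> 'M[R]_n) (x : M) : 'M[R]_n :=
  \matrix_(i, j) laplacian (fun y => B y i j) x.

(* Classical solutions: time runs over [0, +oo) and the values of A at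
   negative times play no role. *)
Definition heat_solution (n : nat) (A0 : M -> 'M[R]_n)
    (A : R -> M -> 'M[R]_n) : Prop :=
  [/\ {within [set p : R * M | 0 <= p.1], continuous (fun p => A p.1 p.2)},
      (forall (t : R) i j, 0 < t -> Ck_manifold 2 (fun x => A t x i j)),
      (forall (t : R) x, 0 < t ->
         is_derive t (1 : R) (fun s => A s x) (laplacian_mx (A t) x)) &
      (forall x, A 0 x = A0 x)].

End Laplacian.

Section MatrixNorms.
Variables (R : realType) (n : nat).
Implicit Types B : 'M[R]_n.

Definition frobenius_norm B : R :=
  Num.sqrt (\sum_(i < n) \sum_(j < n) B i j ^+ 2).

Definition singular_values B : set R :=
  [set s : R | 0 <= s /\ eigenvalue (B^T *m B) (s ^+ 2)].

(* For 0 < n the set is finite and nonempty, so [sup] is its maximum; for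
   n = 0 it is empty and the norm is 0. *)
Definition spectral_norm B : R := sup (singular_values B).

Definition orthogonal_group : set 'M[R]_n :=
  [set B | B^T *m B = 1%:M].

(* K_n, which is also the convex hull of O(n). *)
Definition Kset : set 'M[R]_n :=
  [set B | spectral_norm B <= 1].

End MatrixNorms.

(* Main.v *)
(* For a constant matrix C the pairing <C, A(t, x)> is a scalar solution of the
   heat equation, so by the maximum principle its initial upper bounds persist.
   Taking C = A(t, x) and using ab <= (a^2 + b^2) / 2 gives the Frobenius bound.
   Taking C = v^T (v A(t, x)) shows that A(t, x) is a contraction when A_0 takes
   orthogonal values, and a contraction has determinant in [-1, 1].

   The maximum principle rests on the sign of the Laplace-Beltrami operator at a
   maximum: there it reduces to the contraction of the inverse metric with the
   matrix of second partial derivatives, whose quadratic form is nonpositive. *)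
Require Import Defs.
From mathcomp Require Import all_boot all_order all_algebra.
From mathcomp Require Import all_classical all_reals all_analysis.
From mathcomp Require Import perm ring lra.

Import Order.TTheory GRing.Theory Num.Theory.
Import numFieldNormedType.Exports.

Local Open Scope classical_set_scope.
Local Open Scope ring_scope.

Set Implicit Arguments.
Unset Strict Implicit.

(** * Contractions and positive definite matrices *)

Lemma mulr_mean_le (R : realFieldType) (a b : R) :
  a * b <= (a ^+ 2 + b ^+ 2) / 2.
Proof. by have := sqr_ge0 (a - b); lra. Qed.

Lemma sumr_mul_mean_le (R : realFieldType) (I : finType) (a b : I -> R) :
  \sum_i a i * b i <= (\sum_i a i ^+ 2 + \sum_i b i ^+ 2) / 2.
Proof.
rewrite -big_split /= mulr_suml; apply: ler_sum => i _.
exact: mulr_mean_le.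
Qed.

Definition sqnorm (R : realFieldType) (n : nat) (v : 'rV[R]_n) : R :=
  \sum_j v 0 j ^+ 2.

Lemma sqnormE (R : realFieldType) (n : nat) (v : 'rV[R]_n) :
  sqnorm v = (v *m v^T) 0 0.
Proof. by rewrite mxE; apply: eq_bigr => j _; rewrite mxE expr2. Qed.

Lemma sqnorm_gt0 (R : realFieldType) (n : nat) (v : 'rV[R]_n) :
  v != 0 -> 0 < sqnorm v.
Proof.
move=> /rV0Pn[j vj0]; rewrite /sqnorm (bigD1 j) //= ltr_pwDl ?sumr_ge0 //.
  by rewrite exprn_even_gt0.
by move=> k _; rewrite sqr_ge0.
Qed.

Lemma bernoulli_ge (R : realFieldType) (x : R) (k : nat) :
  0 <= x -> 1 + x *+ k <= (1 + x) ^+ k.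
Proof.
move=> x0; elim: k => [|k IH]; first by rewrite mulr0n addr0 expr0.
rewrite exprS (le_trans _ (ler_wpM2l _ IH)) ?addr_ge0 // mulrSr.
by have := mulr_ge0 x0 (mulrn_wge0 k x0); lra.
Qed.

(** By Bernoulli's inequality the powers of a number above 1 grow at least linearly, hence without
    bound. *)
Lemma le1_of_expr_bounded (R : archiRealFieldType) (x c : R) :
  (forall k, x ^+ k <= c) -> x <= 1.
Proof.
move=> xc; rewrite leNgt; apply/negP => x1.
have x0 : 0 < x - 1 by rewrite subr_gt0.
have [k] : exists k : nat, c / (x - 1) < k%:R.
  exists (Num.bound `|c / (x - 1)|).
  exact: le_lt_trans (ler_norm _) (archi_boundP (normr_ge0 _)).
rewrite ltr_pdivrMr // mulr_natl => ck.
have := bernoulli_ge k (ltW x0); rewrite [1 + (x - 1)]addrC subrK.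
by have := xc k; lra.
Qed.

(** The Leibniz expansion has [n]! terms of absolute value at most 1. The bound is crude, but it
    depends on [n] alone and so serves all powers of a matrix at once. *)
Lemma norm_det_le_fact (R : realFieldType) (n : nat) (B : 'M[R]_n) :
  (forall i j, `|B i j| <= 1) -> `|\det B| <= n`!%:R.
Proof.
move=> B1; rewrite /determinant (le_trans (ler_norm_sum _ _ _)) //.
rewrite -card_Sn -sumr_const; apply: ler_sum => s _.
rewrite normrM normrX normrN1 expr1n mul1r normr_prod.
by rewrite prodr_ile1 // => i _; rewrite normr_ge0 B1.
Qed.

(* The powers of a contraction are contractions, so their entries stay in
   [-1, 1] and |det B|^k = |det (B^k)| is at most n! for every k. *)
Lemma norm_det_contraction (R : archiRealFieldType) (n : nat) (B : 'M[R]_n) :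
  (forall v, sqnorm (v *m B) <= sqnorm v) -> `|\det B| <= 1.
Proof.
move=> B1; apply: (@le1_of_expr_bounded _ _ n`!%:R) => k.
have Bk v : sqnorm (v *m B ^+ k) <= sqnorm v.
  elim: k v => [|k IH] v; first by rewrite expr0 mulmx1.
  by rewrite exprS -mulmxE mulmxA (le_trans (IH _)).
have -> : `|\det B| ^+ k = `|\det (B ^+ k)|.
  elim: k {Bk} => [|k IH]; first by rewrite !expr0 det1 normr1.
  by rewrite !exprS -mulmxE det_mulmx normrM IH.
apply: norm_det_le_fact => i j; rewrite -(ler_pXn2r (n := 2)) ?nnegrE //.
rewrite expr1n real_normK ?num_real //.
(* Row [i] of [B ^+ k] is the image of a unit vector, and one squared entry is at most the squared
   norm of its row. *)
have := Bk (delta_mx 0 i); rewrite -rowE {2}/sqnorm (bigD1 i) //= big1.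
  rewrite mxE !eqxx expr1n addr0; apply: le_trans.
  rewrite /sqnorm (bigD1 j) //= mxE lerDl sumr_ge0 // => l _.
  exact: sqr_ge0.
by move=> l li; rewrite mxE (negbTE li) andbF expr0n.
Qed.

Lemma sqr_frobenius (R : realType) (n : nat) (B : 'M[R]_n) :
  frobenius_norm B ^+ 2 = \sum_i \sum_j B i j ^+ 2.
Proof.
by rewrite sqr_sqrtr // sumr_ge0 // => i _; rewrite sumr_ge0 // => j _; apply: sqr_ge0.
Qed.

(** Cauchy-Schwarz for the pairing of [B] with the rank-one matrix [w^T *m v], where [w = v *m B^T];
    this pairing equals [sqnorm w]. *)
Lemma sqnorm_mul_tr (R : realType) (n : nat) (B : 'M[R]_n) (v : 'rV_n) :
  sqnorm (v *m B^T) <= sqnorm v * frobenius_norm B ^+ 2.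
Proof.
have [->|v0] := eqVneq v 0.
  have s0 : sqnorm (0 : 'rV[R]_n) = 0.
    by rewrite /sqnorm big1 // => j _; rewrite mxE expr0n.
  by rewrite mul0mx s0 mul0r.
have S0 := sqnorm_gt0 v0.
rewrite sqr_frobenius pair_big /= mulrC.
set w := v *m B^T; set S := sqnorm v in S0 *; set F := \sum_p _.
have wE : sqnorm w = \sum_(p : 'I_n * 'I_n) (w 0 p.1 * v 0 p.2) * B p.1 p.2.
  rewrite -(pair_big xpredT xpredT (fun i j => w 0 i * v 0 j * B i j)) /=.
  apply: eq_bigr => i _; rewrite expr2 {2}/w mxE mulr_sumr.
  by apply: eq_bigr => j _; rewrite mxE mulrA.
have wS : \sum_(p : 'I_n * 'I_n) (w 0 p.1 * v 0 p.2) ^+ 2 = sqnorm w * S.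
  rewrite -(pair_big xpredT xpredT (fun i j => (w 0 i * v 0 j) ^+ 2)) /=.
  rewrite mulr_suml; apply: eq_bigr => i _; rewrite mulr_sumr.
  by apply: eq_bigr => j _; rewrite exprMn.
(* Scaling [B] by [S] gives [S * sqnorm w <= (sqnorm w * S + S ^+ 2 * F) / 2]; half of the left side
   is absorbed and one factor [S] cancels. *)
have := sumr_mul_mean_le (fun p : 'I_n * 'I_n => w 0 p.1 * v 0 p.2)
  (fun p => S * B p.1 p.2).
under eq_bigr do rewrite mulrCA.
rewrite -mulr_sumr -wE wS.
under [X in _ + X]eq_bigr do rewrite exprMn.
rewrite -mulr_sumr -/F => h.
have {h} : S * sqnorm w <= S * (F * S) by lra.
by rewrite ler_pM2l.
Qed.

(** If [v] is an eigenvector of [B^T *m B] for [s ^+ 2], then [v *m B^T] has squared norm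
    [s ^+ 2 * sqnorm v], so [s] is at most the Frobenius norm. *)
Lemma spectral_norm_le1 (R : realType) (n : nat) (B : 'M[R]_n) :
  frobenius_norm B <= 1 -> spectral_norm B <= 1.
Proof.
move=> B1; have B2 : frobenius_norm B ^+ 2 <= 1 by rewrite expr_le1 ?sqrtr_ge0.
have ub : ubound (singular_values B) 1.
  move=> s [s0 /eigenvalueP[v vB v0]].
  have := sqnorm_mul_tr B v.
  rewrite sqnormE trmx_mul trmxK mulmxA -(mulmxA v) vB -scalemxAl mxE -sqnormE.
  move=> h; rewrite -(ler_pXn2r (n := 2)) ?nnegrE // expr1n (le_trans _ B2) //.
  by rewrite -(ler_pM2l (sqnorm_gt0 v0)) mulrC.
(* The supremum of the empty set is 0 by convention, so no singular value has to be exhibited. *)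
rewrite /spectral_norm; have [->|ne] := eqVneq (singular_values B) set0.
  by rewrite sup0.
by apply: ge_sup => //; apply/set0P.
Qed.

(** Induction on the size: split off the first row and column, factor the Schur complement [S], and
    border its factor. *)
Lemma cholesky (R : rcfType) (n : nat) (P : 'M[R]_n) :
  P^T = P -> (forall v : 'rV_n, v != 0 -> 0 < (v *m P *m v^T) 0 0) ->
  exists L : 'M[R]_n, P = L *m L^T.
Proof.
elim: n P => [P _ _|n IH]; first by exists 0; apply/matrixP => -[].
rewrite -(add1n n) => P; rewrite -[P]submxK.
set a := ulsubmx P; set b := ursubmx P; set c := dlsubmx P; set C := drsubmx P.
rewrite tr_block_mx => /eq_block_mx[aT cT bT CT] P0.
have cE : c = b^T by rewrite -bT.
pose x := a 0 0; have aE : a = x%:M by rewrite [a]mx11_scalar.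
have quad (u : 'rV_1) (w : 'rV_n) :
    (row_mx u w *m block_mx a b c C *m (row_mx u w)^T) =
    u *m a *m u^T + w *m c *m u^T + (u *m b *m w^T + w *m C *m w^T).
  by rewrite tr_row_mx mul_row_block mul_row_col !mulmxDl.
have x0 : 0 < x.
  have := P0 (row_mx 1%:M 0); rewrite quad !mul0mx !addr0 trmx0 mulmx0 addr0.
  rewrite mul1mx trmx1 mulmx1; apply; apply/eqP => /eqP.
  rewrite row_mx_eq0 => /andP[/eqP /matrixP /(_ 0 0)].
  by rewrite !mxE eqxx => /eqP; rewrite oner_eq0.
pose S := C - x^-1 *: (b^T *m b).
have [|v v0|L SL] := IH S.
- by rewrite /S linearB /= CT linearZ /= trmx_mul trmxK.
(* This vector minimises the form of [P] among those with last block [v]; the minimum is the value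
   of the form of [S] at [v]. *)
- have := P0 (row_mx (- x^-1 *: (v *m b^T)) v); rewrite quad cE aE.
  rewrite mul_mx_scalar scalerA mulrN divff ?gt_eqF // scaleN1r mulNmx addNr add0r.
  rewrite -!scalemxAl scaleNr /S mulmxBr mulmxBl -scalemxAr -scalemxAl mulmxA.
  by rewrite [_ - _]addrC scaleNr; apply; rewrite row_mx_eq0 negb_and v0 orbT.
pose r := Num.sqrt x.
have r0 : r != 0 by rewrite gt_eqF // sqrtr_gt0.
exists (block_mx r%:M 0 (r^-1 *: b^T) L).
rewrite tr_block_mx mulmx_block linearZ /= trmxK tr_scalar_mx !trmx0 !mulmx0.
rewrite !mul0mx !addr0 -scalar_mxM -expr2 sqr_sqrtr ?ltW // -aE.
rewrite mul_scalar_mx scalerA divff // scale1r mul_mx_scalar scalerA divff // scale1r -cE.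
congr block_mx; rewrite -SL /S -scalemxAl -scalemxAr scalerA -invfM -expr2 sqr_sqrtr ?ltW //.
by rewrite cE addrC subrK.
Qed.

Lemma posdef_unitmx (R : realFieldType) (n : nat) (G : 'M[R]_n) :
  (forall v : 'rV_n, v != 0 -> 0 < (v *m G *m v^T) 0 0) -> G \in unitmx.
Proof.
move=> G0; rewrite unitmxE unitfE; apply/negP => /det0P[v v0 vG].
by have := G0 v v0; rewrite vG mul0mx mxE ltxx.
Qed.

(* Writing the inverse of G as L *m L^T turns the sum into the values of the
   quadratic form H on the columns of L, added up. *)
Lemma contraction_inv_posdef_le0 (R : rcfType) (n : nat) (G : 'M[R]_n)
    (H : 'I_n -> 'I_n -> R) :
  G^T = G -> (forall v : 'rV_n, v != 0 -> 0 < (v *m G *m v^T) 0 0) ->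
  (forall p : 'rV_n, \sum_k \sum_l p 0 k * p 0 l * H k l <= 0) ->
  \sum_k \sum_l invmx G k l * H k l <= 0.
Proof.
move=> GT G0 H0; have uG := posdef_unitmx G0.
have [||L ->] := @cholesky _ _ (invmx G).
- by rewrite trmx_inv GT.
(* The form of the inverse at [v] equals the form of [G] at [u]. *)
- move=> v v0; have vK := mulmxKV uG v; set u := v *m invmx G in vK *.
  rewrite -vK trmx_mul GT mulmxA G0 //.
  by apply: contra_neq v0 => u0; rewrite -vK u0 mul0mx.
under eq_bigr do under eq_bigr do rewrite mxE mulr_suml.
under eq_bigr do rewrite exchange_big /=.
rewrite exchange_big /= sumr_le0 // => m _.
rewrite (le_trans _ (H0 (\row_k L k m))) // ler_sum // => k _.
by apply: ler_sum => l _; rewrite !mxE.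
Qed.

(** * Chain rule and second derivative test *)

Section LineDerivative.
Variables (R : realType) (V W : normedModType R).
Implicit Types (F : V -> W).

(** Both difference quotients are the same function of the increment. This carries one-variable
    calculus over to directional derivatives. *)
Lemma is_derive_line F (x v : V) (s : R) (dF : W) :
  is_derive (s *: v + x) v F dF <-> is_derive s 1 (fun h => F (h *: v + x)) dF.
Proof.
have E : (fun h : R => h^-1 *: ((F \o shift (s *: v + x)) (h *: v) - F (s *: v + x)))
   = (fun h : R => h^-1 *: (((fun h => F (h *: v + x)) \o shift s) (h *: 1)
        - F (s *: v + x))).
  apply/funext => h /=; congr (_ *: (F _ - _)).
  by rewrite addrA -scalerDl [h *: 1]mulr1.
by split=> -[]; rewrite /derivable /derive => cF dF0; split;
  rewrite /derivable /derive; move: cF dF0; rewrite E.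
Qed.

Lemma is_derive_bigsum (I : Type) (r : seq I) (F : I -> V -> W) (dF : I -> W)
    (x v : V) :
  (forall i, is_derive x v (F i) (dF i)) ->
  is_derive x v (fun z => \sum_(i <- r) F i z) (\sum_(i <- r) dF i).
Proof.
move=> hF; elim: r => [|i r IH].
  rewrite big_nil (_ : (fun z => _) = cst 0); first exact: is_derive_cst.
  by apply/funext => z; rewrite big_nil.
rewrite big_cons (_ : (fun z => _) = F i + (fun z => \sum_(i <- r) F i z)).
  exact: is_deriveD.
by apply/funext => z; rewrite big_cons.
Qed.

Lemma derivable_bigsum (I : Type) (r : seq I) (F : I -> V -> W) (x v : V) :
  (forall i, derivable (F i) x v) ->
  derivable (fun z => \sum_(i <- r) F i z) x v.
Proof.
move=> hF; suff [] : is_derive x v (fun z => \sum_(i <- r) F i z)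
    (\sum_(i <- r) 'D_v (F i) x) by [].
by apply: is_derive_bigsum => i; apply: derivableP.
Qed.

End LineDerivative.

Section RealDerivative.
Variable R : realType.

(** A form of the mean value theorem for increments [b] of either sign. *)
Lemma MVT_center (f df : R -> R) (b : R) :
  (forall s : R, `|s| <= `|b| -> is_derive s 1 f (df s)) ->
  exists2 s : R, `|s| <= `|b| & f b - f 0 = df s * b.
Proof.
move=> fD; have fc (i : interval R) :
    (forall s : R, s \in i -> `|s| <= `|b|) -> {within [set` i], continuous f}.
  by move=> ib; apply: derivable_within_continuous => s /ib /fD[].
have [b0|b0] := leP 0 b.
  have I s : s \in `[0, b] -> `|s| <= `|b|.
    by rewrite in_itv /= => /andP[s0 sb]; rewrite !ger0_norm.
  have fD' s : s \in `]0, b[ -> is_derive s 1 f (df s).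
    by move=> /subset_itv_oo_cc /I /fD.
  have [s sI ->] := MVT_segment b0 fD' (fc _ I).
  by exists s; rewrite ?subr0 ?I.
have I s : s \in `[b, 0] -> `|s| <= `|b|.
  by rewrite in_itv /= => /andP[s0 sb]; rewrite !ler0_norm ?lerN2 // ltW.
have fD' s : s \in `]b, 0[ -> is_derive s 1 f (df s).
  by move=> /subset_itv_oo_cc /I /fD.
have [s sI E] := MVT_segment (ltW b0) fD' (fc _ I).
by exists s; rewrite ?I // -[LHS]opprB E sub0r mulrN opprK.
Qed.

(** If [c] were positive, the derivative [q] would be positive just to the right of 0, and by the
    mean value theorem [f] would exceed [f 0] there. *)
Lemma second_derivative_at_max (f q : R -> R) (c : R) :
  (\forall s \near 0, is_derive (s : R) (1 : R) f (q s)) -> q 0 = 0 ->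
  is_derive (0 : R) 1 q c -> (forall s, f s <= f 0) -> c <= 0.
Proof.
move=> fD q0 [qD qc] fmax; rewrite leNgt; apply/negP => c0.
have qpos : \forall h \near 0^', 0 < h^-1 * q h.
  have : (h^-1 *: ((q \o shift 0) (h *: 1) - q 0) @[h --> 0^'] --> c)%R.
    by rewrite -qc; exact: qD.
  move=> /cvgr_gt /(_ _ c0); apply: filterS => h /=.
  by rewrite q0 subr0 addr0 [h *: 1]mulr1.
have /nbhs_ballP[r /= r0 rP] : \forall h \near 0,
    is_derive (h : R) (1 : R) f (q h) /\ (h != 0 -> 0 < h^-1 * q h).
  apply: filterS2 fD qpos => h ? ?; split=> //.
have hP (h : R) : 0 <= h -> h <= r / 2 ->
    is_derive (h : R) (1 : R) f (q h) /\ (h != 0 -> 0 < h^-1 * q h).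
  move=> h0 hr; apply: rP; rewrite /ball /= sub0r normrN ger0_norm //; lra.
have [|||s] := @MVT _ f q 0 (r / 2).
- by rewrite divr_gt0.
- by move=> s; rewrite in_itv /= => /andP[/ltW s0 /ltW sr]; apply (hP _ s0 sr).1.
- apply: derivable_within_continuous => s; rewrite in_itv /= => /andP[s0 sr].
  by case: (hP _ s0 sr) => -[].
rewrite in_itv /= subr0 => /andP[s0 sr] E.
have := (hP _ (ltW s0) (ltW sr)).2; rewrite gt_eqF // => /(_ isT).
rewrite pmulr_rgt0 ?invr_gt0 // => qs.
have : 0 < q s * (r / 2) by rewrite mulr_gt0 // divr_gt0.
by rewrite -E subr_gt0 ltNge fmax.
Qed.

End RealDerivative.

Section PartialDerivatives.
Variables (R : realType) (d : nat).
Implicit Types (D : set 'rV[R]_d) (F : 'rV[R]_d -> R).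

(* By the mean value theorem along e_k; since q is arbitrary, directions can be
   built up one coordinate at a time. *)
Lemma derive_quotient_step D F (y q : 'rV[R]_d) (c : R) (k : 'I_d) :
  open D -> D y ->
  (forall z, D z -> derivable F z (delta_mx 0 k)) ->
  {for y, continuous (partial k F)} ->
  h^-1 *: (F (h *: (c *: delta_mx 0 k + q) + y) - F (h *: q + y)) @[h --> 0^']
    --> c * partial k F y.
Proof.
move=> oD Dy FD Fc; apply/cvgrPdist_lt => e e0.
have c1 : 0 < `|c| + 1 by rewrite ltr_wpDl.
set ek : 'rV[R]_d := delta_mx 0 k.
(* The mean value theorem multiplies this error by [c]; the denominator [|c| + 1] absorbs that
   factor and is never 0. *)
have : \forall z \near y, D z /\ `|partial k F y - partial k F z| < e / (`|c| + 1).
  apply: filterI; first exact: open_nbhs_nbhs.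
  by move/cvgrPdist_lt : Fc; apply; rewrite divr_gt0.
move=> /nbhs_ballP[r /= r0 rP].
have K0 : 0 < `|c| * `|ek| + `|q| + 1.
  by rewrite ltr_wpDl // addr_ge0 // mulr_ge0.
near=> h.
(* This keeps every point [s *: ek + (h *: q + y)] with [|s| <= |h * c|] in the ball of radius [r]
   around [y]. *)
have hr : `|h| * (`|c| * `|ek| + `|q| + 1) < r.
  rewrite -ltr_pdivlMr //; near: h; apply: dnbhs0_lt; exact: divr_gt0.
have h0 : h != 0 by near: h; exact: nbhs_dnbhs_neq.
have small s : `|s| <= `|h * c| ->
    D (s *: ek + (h *: q + y)) /\
    `|partial k F y - partial k F (s *: ek + (h *: q + y))| < e / (`|c| + 1).
  move=> sh; apply: rP; rewrite -ball_normE /= addrA opprD addrCA subrr addr0 normrN.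
  apply: le_lt_trans hr; rewrite (le_trans (ler_normD _ _)) // !normrZ.
  rewrite !mulrDr mulrA -normrM mulr1 -addrA lerD ?ler_wpM2r //.
  by rewrite lerDl.
have [s sh|s sh] := @MVT_center R (fun s => F (s *: ek + (h *: q + y)))
    (fun s => partial k F (s *: ek + (h *: q + y))) (h * c).
  have [Ds _] := small s sh.
  exact: (is_derive_line F _ ek s _).1 (derivableP (FD _ Ds)).
rewrite scale0r add0r -scalerA addrA -scalerDr => ->.
rewrite [h^-1 *: _]mulrCA mulKf // [_ * c]mulrC -mulrBr normrM.
have [_ hs] := small s sh.
apply: le_lt_trans (ler_wpM2l (normr_ge0 c) (ltW hs)) _.
by rewrite mulrCA gtr_pMr // ltr_pdivrMr // mul1r ltrDl.
Unshelve. all: by end_near. Qed.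

Lemma is_derive_partial D F (y p : 'rV[R]_d) : open D -> D y -> Ck_on 1 D F ->
  is_derive y p F (\sum_k p 0 k * partial k F y).
Proof.
move=> oD Dy [_ FD].
rewrite [p in is_derive _ p](row_sum_delta p).
(* The coordinates of [p] enter one at a time; the quotient of the new step and that of the previous
   direction telescope. *)
elim: (index_enum _) => [|k r IH]; first by rewrite !big_nil; exact: is_derive0.
rewrite !big_cons; move: IH; set q := \sum_(j <- r) _ => -[qD qE].
have [FkD [Fc _]] := FD k.
have : h^-1 *: (F (h *: (p 0 k *: delta_mx 0 k + q) + y) - F y) @[h --> 0^'] -->
    p 0 k * partial k F y + \sum_(j <- r) p 0 j * partial j F y.
  rewrite -qE.
  have H1 := @derive_quotient_step D F y q (p 0 k) k oD Dy FkD (Fc _ Dy).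
  have H2 : h^-1 *: (F (h *: q + y) - F y) @[h --> 0^'] --> 'D_q F y by exact: qD.
  apply: cvg_trans (cvgD H1 H2).
  apply: near_eq_cvg; apply: nearW => h /=.
  by rewrite -[LHS]scalerDr subrKA.
by move=> lim; split; [apply/cvg_ex; eexists; exact: lim|exact: cvg_lim lim].
Qed.

Lemma line_near D (p y : 'rV[R]_d) : open D -> D y ->
  \forall s \near (0 : R), D (s *: p + y).
Proof.
move=> oD Dy; have : {for 0, continuous (fun s : R => s *: p + y)}.
  by apply: cvgD; [exact: scalel_continuous|exact: cvg_cst].
by apply; rewrite scale0r add0r; exact: open_nbhs_nbhs.
Qed.

Lemma partial_at_max D F (y : 'rV[R]_d) (k : 'I_d) : open D -> D y ->
  (forall z, D z -> derivable F z (delta_mx 0 k)) ->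
  (forall z, F z <= F y) -> partial k F y = 0.
Proof.
move=> oD Dy FD Fmax; set ek : 'rV[R]_d := delta_mx 0 k.
have /nbhs_ballP[r /= r0 rP] := line_near ek oD Dy.
have [|s||s|] := @derive1_at_max _ (fun s => F (s *: ek + y)) (- r) r 0.
- lra.
- rewrite in_itv /= -ltr_norml => sr.
  have [] := (is_derive_line F y ek s (partial k F (s *: ek + y))).1 _; last by [].
  apply/derivableP/FD/rP; by rewrite /ball /= sub0r normrN.
- by rewrite in_itv /= oppr_lt0 r0.
- by rewrite scale0r add0r Fmax.
- move=> d0 dE; have : is_derive (0 : R) 1 (fun s => F (s *: ek + y)) 0 by split.
  by move/is_derive_line; rewrite scale0r add0r => -[].
Qed.

(** Along the line through [y] in direction [p], the chain rule gives [q] as the first derivative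
    and the quadratic form as the second derivative at 0. *)
Lemma second_partials_at_max D F (y p : 'rV[R]_d) : open D -> D y ->
  Ck_on 2 D F -> (forall z, F z <= F y) ->
  \sum_k \sum_l p 0 k * p 0 l * partial k (partial l F) y <= 0.
Proof.
move=> oD Dy F2 Fmax.
have F1 : Ck_on 1 D F.
  by case: F2 => Fc FD; split=> // k; have [? [? _]] := FD k.
pose q (s : R) := \sum_l p 0 l * partial l F (s *: p + y).
apply: (@second_derivative_at_max R (fun s => F (s *: p + y)) q).
- apply: filterS (line_near p oD Dy) => s Ds.
  exact: (is_derive_line F y p s _).1 (is_derive_partial p oD Ds F1).
- rewrite /q big1 // => l _; rewrite scale0r add0r (partial_at_max oD Dy) ?mulr0 //.
  by case: F2 => _ /(_ l)[].
- rewrite exchange_big /=; apply: is_derive_bigsum => l.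
  have [_ Fl1] := F2.2 l.
  have Hl : is_derive (0 : R) 1 (fun s => partial l F (s *: p + y))
      (\sum_k p 0 k * partial k (partial l F) y).
    apply: (is_derive_line (partial l F) y p 0 _).1.
    by rewrite scale0r add0r; exact: is_derive_partial oD Dy Fl1.
  apply: is_derive_eq (is_deriveZ (p 0 l) Hl) _.
  by rewrite scaler_sumr; apply: eq_bigr => k _; rewrite [_ *: _]mulrA [p 0 l * _]mulrC.
- by move=> s; rewrite scale0r add0r.
Qed.

End PartialDerivatives.

(** * Laplace-Beltrami operator and maximum principle *)

Section Derivability.
Variables (R : realType) (V : normedModType R).
Implicit Types (x v : V).

Lemma derivable_bigprod (I : Type) (r : seq I) (f : I -> V -> R) x v :
  (forall i, derivable (f i) x v) ->
  derivable (fun z => \prod_(i <- r) f i z) x v.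
Proof.
move=> fD; elim: r => [|i r IH].
  rewrite (_ : (fun z => _) = cst 1); first exact: derivable_cst.
  by apply/funext => z; rewrite big_nil.
rewrite (_ : (fun z => _) = f i * (fun z => \prod_(i <- r) f i z)).
  exact: derivableM.
by apply/funext => z; rewrite big_cons.
Qed.

Lemma derivable_det (n : nat) (G : V -> 'M[R]_n) x v :
  (forall i j, derivable (fun z => G z i j) x v) ->
  derivable (fun z => \det (G z)) x v.
Proof.
move=> GD; apply: derivable_bigsum => s.
apply: derivableM; first exact: derivable_cst.
by apply: derivable_bigprod => i; exact: GD.
Qed.

Lemma derivable_invmx (n : nat) (G : V -> 'M[R]_n) x v :
  (\forall z \near x, G z \in unitmx) ->
  (forall i j, derivable (fun z => G z i j) x v) ->
  forall i j, derivable (fun z => invmx (G z) i j) x v.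
Proof.
move=> Gu GD i j.
(* Cofactor formula. [invmx] agrees with it only at invertible matrices, hence the assumption on a
   whole neighbourhood. *)
pose f z := (\det (G z))^-1 * ((-1) ^+ (j + i) * \det (row' j (col' i (G z)))).
apply: (@near_eq_derivable _ _ _ f).
  by apply: filterS Gu => z Gz; rewrite /f /invmx Gz !mxE.
apply: derivableM; last first.
  apply: derivableM; first exact: derivable_cst.
  apply: derivable_det => k l.
  by under eq_fun do rewrite !mxE; exact: GD.
apply: derivableV; last exact: derivable_det.
by have := nbhs_singleton Gu; rewrite unitmxE unitfE.
Qed.

Lemma derivable_sqrt (f : V -> R) x v :
  derivable f x v -> 0 < f x -> derivable (fun z => Num.sqrt (f z)) x v.
Proof.
move=> fD f0; pose h (s : R) := f (s *: v + x).
have hD : is_derive (0 : R) 1 h ('D_v f x).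
  apply: (is_derive_line f x v 0 _).1.
  by rewrite scale0r add0r; exact: derivableP.
have sD : is_derive (h 0) 1 Num.sqrt (2 * Num.sqrt (h 0))^-1.
  by apply: is_derive1_sqrt; rewrite /h scale0r add0r.
have [+ _] := (is_derive_line (fun z => Num.sqrt (f z)) x v 0 _).2
  (is_derive1_comp sD hD).
by rewrite scale0r add0r.
Qed.

Lemma is_derive_lincomb (I : Type) (r : seq I) (c : I -> R) (f : I -> V -> R)
    (df : I -> R) x v :
  (forall i, is_derive x v (f i) (df i)) ->
  is_derive x v (fun z => \sum_(i <- r) c i * f i z) (\sum_(i <- r) c i * df i).
Proof.
by move=> fD; apply: is_derive_bigsum => i; exact: is_deriveZ (c i) (fD i).
Qed.

End Derivability.

Lemma continuous_lincomb_at (R : realType) (T : topologicalType) (I : Type)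
    (r : seq I) (c : I -> R) (f : I -> T -> R) (x : T) :
  (forall i, {for x, continuous (f i)}) ->
  {for x, continuous (fun z => \sum_(i <- r) c i * f i z)}.
Proof.
move=> fc; apply: cvg_big; first exact: add_continuous.
by move=> i _; apply: cvgM; [exact: cvg_cst|exact: fc].
Qed.

Section PartialLinear.
Variables (R : realType) (d : nat) (D : set 'rV[R]_d).
Hypothesis oD : open D.
Implicit Types (F G : 'rV[R]_d -> R).

Lemma partial_eq_on F G (k : 'I_d) y : D y -> (forall z, D z -> F z = G z) ->
  partial k F y = partial k G y.
Proof.
move=> Dy FG; apply: near_eq_derive.
by apply: filterS (open_nbhs_nbhs (conj oD Dy)) => z /FG.
Qed.

Lemma continuous_eq_on F G y : D y -> (forall z, D z -> F z = G z) ->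
  {for y, continuous F} -> {for y, continuous G}.
Proof.
move=> Dy FG Fc; have : G z @[z --> y] --> F y.
  have nFG : \forall z \near y, F z = G z.
    by apply: filterS (open_nbhs_nbhs (conj oD Dy)) => z /FG.
  exact: cvg_trans (near_eq_cvg nFG) Fc.
by rewrite FG.
Qed.

(** Continuity and derivatives are local and [D] is open. Functions here are total, while formulas
    for their partial derivatives hold only on [D]. *)
Lemma Ck_on_eq (m : nat) F G : (forall z, D z -> F z = G z) ->
  Ck_on m D F -> Ck_on m D G.
Proof.
elim: m F G => [|m IH] F G FG [Fc FD].
  by split=> // y Dy; exact: continuous_eq_on (Fc y Dy).
split=> [y Dy|k]; first exact: continuous_eq_on (Fc y Dy).
have [FkD FkC] := FD k; split=> [y Dy|].
  have nFG : \forall z \near y, F z = G z.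
    by apply: filterS (open_nbhs_nbhs (conj oD Dy)) => z /FG.
  exact: near_eq_derivable nFG (FkD y Dy).
by apply: IH FkC => z Dz; exact: partial_eq_on.
Qed.

Variables (I : Type) (r : seq I) (c : I -> R) (F_ : I -> 'rV[R]_d -> R).

Lemma partial_lincomb (k : 'I_d) y :
  (forall i, derivable (F_ i) y (delta_mx 0 k)) ->
  partial k (fun z => \sum_(i <- r) c i * F_ i z) y =
  \sum_(i <- r) c i * partial k (F_ i) y.
Proof.
move=> FD.
by have [] := is_derive_lincomb r c (fun i => derivableP (FD i)).
Qed.

End PartialLinear.

Lemma Ck_on_lincomb (R : realType) (d m : nat) (D : set 'rV[R]_d) (I : Type)
    (r : seq I) (c : I -> R) (F : I -> 'rV[R]_d -> R) :
  open D -> (forall i, Ck_on m D (F i)) ->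
  Ck_on m D (fun z => \sum_(i <- r) c i * F i z).
Proof.
move=> oD; elim: m F => [|m IH] F FC.
  by split=> // y Dy; apply: continuous_lincomb_at => i; apply: (FC i).1.
split=> [y Dy|k].
  by apply: continuous_lincomb_at => i; apply: (FC i).1.
split=> [y Dy|].
  have FD i := derivableP (((FC i).2 k).1 y Dy).
  by have [] := is_derive_lincomb r c FD.
have := IH (fun i => partial k (F i)) (fun i => ((FC i).2 k).2).
apply: Ck_on_eq => // z Dz; rewrite partial_lincomb // => i.
exact: ((FC i).2 k).1.
Qed.

Section LaplaceBeltrami.
Variables (R : realType) (d : nat) (M : closedManifold R d).
Variable g : riemannianMetric M.
Implicit Types (i : atlas_index M) (F : 'rV[R]_d -> R) (f : M -> R).

Let cod i := chart_cod (atlas i).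

Let oC i : open (cod i).
Proof. exact: chart_cod_open. Qed.

Let posdef i y : cod i y ->
  forall v : 'rV_d, v != 0 -> 0 < (v *m metric g i y *m v^T) 0 0.
Proof. by move=> iy v; exact: metric_posdef. Qed.

(** A Cholesky factor makes the determinant a square, and invertibility makes it nonzero. *)
Lemma metric_det_gt0 i y : cod i y -> 0 < \det (metric g i y).
Proof.
move=> iy; have [L E] := cholesky (metric_symmetric g iy) (posdef iy).
have := posdef_unitmx (posdef iy); rewrite unitmxE unitfE E det_mulmx det_tr -expr2.
by rewrite lt0r sqr_ge0 andbT.
Qed.

(** The coefficients under the outer derivative in the divergence form of the operator. *)
Let weight i (k l : 'I_d) (z : 'rV[R]_d) : R :=
  Num.sqrt (\det (metric g i z)) * invmx (metric g i z) k l.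

Lemma derivable_weight i k l y v : cod i y ->
  (forall a b, derivable (fun z => metric g i z a b) y v) ->
  derivable (weight i k l) y v.
Proof.
move=> iy gD; apply: derivableM.
  apply: (@derivable_sqrt _ _ (fun z => \det (metric g i z)) _ _ _ (metric_det_gt0 iy)).
  exact: (@derivable_det _ _ _ (metric g i)).
apply: (@derivable_invmx _ _ _ (metric g i)) => //.
apply: filterS (open_nbhs_nbhs (conj (@oC i) iy)) => z iz.
exact: posdef_unitmx (posdef iz).
Qed.

(** The product rule separates a first-order part, which drops out at critical points, from the
    second-order part; linearity in [F] can then be read off. *)
Lemma laplacian_inE i F y : cod i y -> Ck_on 2 (cod i) F ->
  laplacian_in g i F y = (Num.sqrt (\det (metric g i y)))^-1 *
    \sum_k \sum_l (partial k (weight i k l) y * partial l F y +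
                   weight i k l y * partial k (partial l F) y).
Proof.
move=> iy F2; rewrite /laplacian_in; congr (_ * _); apply: eq_bigr => k _.
rewrite (_ : (fun z => _) =
    fun z => \sum_l (weight i k l * partial l F) z); last first.
  by apply/funext => z; rewrite mulr_sumr; apply: eq_bigr => l _; rewrite mulrA.
have wD l : derivable (weight i k l) y (delta_mx 0 k).
  by apply: derivable_weight => // a b; exact: ((metric_smooth g i a b 1).2 k).1.
have FD l : derivable (partial l F) y (delta_mx 0 k).
  exact: (((F2.2 l).2).2 k).1.
have [_ E] := is_derive_bigsum (index_enum _)
  (fun l => is_deriveM (derivableP (wD l)) (derivableP (FD l))).
rewrite [LHS]E; apply: eq_bigr => l _; rewrite addrC; congr (_ + _).
exact: mulrC.
Qed.

Lemma laplacian_in_lincomb i (I : Type) (r : seq I) (c : I -> R)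
    (F : I -> 'rV[R]_d -> R) y :
  cod i y -> (forall j, Ck_on 2 (cod i) (F j)) ->
  laplacian_in g i (fun z => \sum_(j <- r) c j * F j z) y =
  \sum_(j <- r) c j * laplacian_in g i (F j) y.
Proof.
move=> iy FC.
rewrite laplacian_inE //; last exact: Ck_on_lincomb.
under [RHS]eq_bigr do rewrite laplacian_inE // mulrCA mulr_sumr.
rewrite -mulr_sumr; congr (_ * _).
rewrite [RHS]exchange_big /=; apply: eq_bigr => k _.
under [RHS]eq_bigr do rewrite mulr_sumr.
rewrite [RHS]exchange_big /=; apply: eq_bigr => l _.
have E z : cod i z -> partial l (fun z => \sum_(j <- r) c j * F j z) z =
    \sum_(j <- r) c j * partial l (F j) z.
  by move=> iz; rewrite partial_lincomb // => j; exact: ((FC j).2 l).1.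
rewrite E // (partial_eq_on (@oC i) k iy E) partial_lincomb; last first.
  by move=> j; exact: ((((FC j).2 l).2).2 k).1.
rewrite !mulr_sumr -big_split /=; apply: eq_bigr => j _.
by rewrite mulrDr; congr (_ + _); rewrite mulrCA.
Qed.

Lemma laplacian_lincomb (I : Type) (r : seq I) (c : I -> R) (f : I -> M -> R) x :
  (forall j, Ck_manifold 2 (f j)) ->
  laplacian g (fun z => \sum_(j <- r) c j * f j z) x =
  \sum_(j <- r) c j * laplacian g (f j) x.
Proof.
move=> fC; rewrite /laplacian.
rewrite -(laplacian_in_lincomb r c (chart_map_cod (chart_at_dom x))) //.
by move=> j; exact: fC.
Qed.

Lemma Ck_manifold_lincomb m (I : Type) (r : seq I) (c : I -> R)
    (f : I -> M -> R) :
  (forall j, Ck_manifold m (f j)) ->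
  Ck_manifold m (fun z => \sum_(j <- r) c j * f j z).
Proof.
move=> fC i; apply: (Ck_on_lincomb r c (@oC i)) => j.
exact: fC.
Qed.

Lemma laplacian_at_max f x : Ck_manifold 2 f -> (forall z, f z <= f x) ->
  laplacian g f x <= 0.
Proof.
move=> fC fmax; rewrite /laplacian; set i := chart_at x.
set y := chart_map _ x; set F := local_rep i f.
have iy : cod i y := chart_map_cod (chart_at_dom x).
(* This holds even outside the chart codomain: [chart_inv] is total, so [F] takes only values of
   [f]. *)
have Fmax z : F z <= F y.
  by rewrite /F /local_rep /y chart_mapK ?fmax //; exact: chart_at_dom.
have FC : Ck_on 2 (cod i) F by exact: fC.
rewrite laplacian_inE //.
have F1 l : partial l F y = 0.
  by apply: partial_at_max (@oC i) iy _ Fmax; exact: (FC.2 l).1.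
(* With the first-order part gone, the square root of the determinant factors out of both sums and
   cancels the prefactor. *)
under eq_bigr do under eq_bigr do rewrite F1 mulr0 add0r /weight -mulrA.
under eq_bigr do rewrite -mulr_sumr.
rewrite -mulr_sumr mulKf; last by rewrite gt_eqF // sqrtr_gt0 metric_det_gt0.
apply: contraction_inv_posdef_le0.
- exact: metric_symmetric.
- exact: posdef.
- by move=> p; exact: second_partials_at_max (@oC i) iy FC Fmax.
Qed.

(* Subtracting e * s makes the solution strictly subcaloric, so a maximum of
   u(s, z) - e * s over [0, t] * M can only be attained at s = 0. *)
Lemma heat_maximum_principle (u : R -> M -> R) (m : R) :
  {within [set p : R * M | 0 <= p.1], continuous (fun p => u p.1 p.2)} ->
  (forall t : R, 0 < t -> Ck_manifold 2 (u t)) ->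
  (forall (t : R) x, 0 < t -> is_derive t (1 : R) (fun s => u s x) (laplacian g (u t) x)) ->
  (forall x, u 0 x <= m) ->
  forall (t : R) x, 0 <= t -> u t x <= m.
Proof.
move=> uc uC uD u0 t x; rewrite le_eqVlt => /predU1P[<-//|t0].
rewrite leNgt; apply/negP => mu.
(* With this [e], the value of [w] at [(t, x)] is the mean of [u t x] and [m], still above [m]. *)
pose e := (u t x - m) / (2 * t).
have e0 : 0 < e by rewrite divr_gt0 ?subr_gt0 // mulr_gt0.
pose K : set (R * M) := `[0, t]%classic `*` setT.
have Ktx : K (t, x) by split => //=; rewrite in_itv /= lexx ltW.
pose w (p : R * M) := u p.1 p.2 - e * p.1.
have Kc : compact K.
  by apply: compact_setX; [exact: segment_compact|exact: carrier_compact].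
have wc : {within K, continuous w}.
  have uK : {within K, continuous (fun p => u p.1 p.2)}.
    apply: continuous_subspaceW uc => -[s z] [/=].
    by rewrite in_itv /= => /andP[].
  have ec : {within K, continuous (fun p : R * M => e * p.1)}.
    apply: continuous_subspaceT => p.
    by apply: cvgM; [exact: cvg_cst|exact: cvg_fst].
  by move=> p; apply: cvgB; [exact: uK|exact: ec].
have [[s z] /set_mem[/= + _] wmax] := compact_EVT_max (ex_intro _ _ Ktx) Kc wc.
rewrite in_itv /= => /andP[s0 st].
have {}wmax s' z' : 0 <= s' <= t -> u s' z' - e * s' <= u s z - e * s.
  by move=> s't; apply: (wmax (s', z')); apply/mem_set; split => //=; rewrite in_itv.
have mw : m < u s z - e * s.
  apply: lt_le_trans (wmax t x _); last by rewrite lexx ltW.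
  have -> : e * t = (u t x - m) / 2.
    by rewrite /e; field; rewrite gt_eqF.
  lra.
have {}s0 : 0 < s.
  rewrite lt_neqAle s0 andbT; apply/eqP => s00.
  by move: mw; rewrite -s00 mulr0 subr0 ltNge u0.
(* At the fixed time [s], [z] maximises [u s]; so the time derivative there is at most 0, hence
   below [e]. *)
have lap0 : laplacian g (u s) z <= 0.
  apply: laplacian_at_max; first exact: uC.
  by move=> z'; have := wmax s z'; rewrite (ltW s0) st lerD2r => ->.
have [dD dE] := uD s z s0.
have : h^-1 *: (u (h *: 1 + s) z - u s z) @[h --> 0^'] --> laplacian g (u s) z.
  by rewrite -dE; exact: dD.
move=> /cvgr_lt /(_ _ (le_lt_trans lap0 e0)) /nbhs_ballP[r /= r0 rP].
(* The step goes backwards in time because [s] may equal [t]; its size keeps [h + s] nonnegative and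
   [h] within the radius [r]. *)
pose h := - (Num.min r s / 2).
have rs0 : 0 < Num.min r s by rewrite lt_min r0 s0.
have [rsr rss] : Num.min r s <= r /\ Num.min r s <= s by rewrite !ge_min !lexx orbT.
have h0 : h < 0 by rewrite /h oppr_lt0 divr_gt0.
have := rP h _ _; rewrite /ball /= sub0r normrN ltr0_norm // lt_eqF //.
have -> : - h < r by rewrite /h; lra.
move=> /(_ isT isT); rewrite [h *: 1]mulr1 ltNge => /negP; apply.
(* Maximality of [w] gives [u (h + s) z - u s z <= e * h]; dividing by the negative [h] bounds the
   quotient below by [e], a contradiction. *)
rewrite -(ler_nM2l h0) [h * (_ *: _)]mulrA divff ?lt_eqF // mul1r.
have hs : 0 <= h + s <= t by rewrite /h; apply/andP; split; lra.
by have := wmax _ z hs; rewrite mulrDr [h * e]mulrC; lra.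
Qed.

End LaplaceBeltrami.

(** * Bounds for matrix-valued solutions of the heat equation *)

Section MatrixHeatFlow.
Variables (R : realType) (d n : nat) (M : closedManifold R d).
Variables (g : riemannianMetric M) (A0 : M -> 'M[R]_n) (A : R -> M -> 'M[R]_n).
Hypothesis hA : heat_solution g A0 A.

(** The coefficients are constant in time and space, so continuity, regularity, the Laplacian and
    the time derivative all pass through the sum. *)
Lemma pairing_le (C : 'M[R]_n) (m : R) :
  (forall x, \sum_(p : 'I_n * 'I_n) C p.1 p.2 * A0 x p.1 p.2 <= m) ->
  forall (t : R) x, 0 <= t -> \sum_(p : 'I_n * 'I_n) C p.1 p.2 * A t x p.1 p.2 <= m.
Proof.
case: hA => Ac AC AD A00 C0.
apply: (@heat_maximum_principle _ _ _ g
  (fun t x => \sum_(p : 'I_n * 'I_n) C p.1 p.2 * A t x p.1 p.2)).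
- move=> p; apply: continuous_lincomb_at => ij.
  exact: cvg_comp (Ac p) (@coord_continuous _ _ _ ij.1 ij.2 (A p.1 p.2)).
- move=> t t0; apply: Ck_manifold_lincomb => ij; exact: AC.
- move=> t x t0; rewrite laplacian_lincomb; last by move=> ij; exact: AC.
  apply: is_derive_lincomb => ij.
  have [dA dE] := AD t x t0; split; first by move/derivable_mxP: dA; exact.
  by move: dE; rewrite derive_mx // => /matrixP /(_ ij.1 ij.2); rewrite !mxE.
- by move=> x; rewrite A00.
Qed.

Lemma frobenius_norm_le1 : (forall x, frobenius_norm (A0 x) = 1) ->
  forall (t : R) x, 0 <= t -> frobenius_norm (A t x) <= 1.
Proof.
move=> A01 t x t0; rewrite -(ler_pXn2r (n := 2)) ?nnegrE ?sqrtr_ge0 //.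
have E (B : 'M[R]_n) : frobenius_norm B ^+ 2 = \sum_(p : 'I_n * 'I_n) B p.1 p.2 ^+ 2.
  by rewrite sqr_frobenius pair_big.
(* [A t x] is frozen as the constant matrix; the initial bound holds at every point because [A0] has
   Frobenius norm 1 everywhere. *)
have := @pairing_le (A t x) ((frobenius_norm (A t x) ^+ 2 + 1) / 2) _ t x t0.
under eq_bigr do rewrite -expr2.
rewrite -E expr1n => h; suff : frobenius_norm (A t x) ^+ 2 <=
  (frobenius_norm (A t x) ^+ 2 + 1) / 2 by lra.
apply: h => z; have := sumr_mul_mean_le
  (fun p : 'I_n * 'I_n => A t x p.1 p.2) (fun p => A0 z p.1 p.2).
by rewrite -!E A01 expr1n.
Qed.

Lemma sqnorm_flow_le (v : 'rV[R]_n) : (forall x, orthogonal_group (A0 x)) ->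
  forall (t : R) x, 0 <= t -> sqnorm (v *m A t x) <= sqnorm v.
Proof.
move=> A0O t x t0; set w := v *m A t x.
(* Pairing with the rank-one matrix [v^T *m w] is the scalar product of [v *m B] with [w]. *)
have E (B : 'M[R]_n) : \sum_(p : 'I_n * 'I_n) (v^T *m w) p.1 p.2 * B p.1 p.2 =
    \sum_j (v *m B) 0 j * w 0 j.
  rewrite -(pair_big xpredT xpredT (fun i j => (v^T *m w) i j * B i j)) /=.
  rewrite exchange_big /=; apply: eq_bigr => j _; rewrite mxE mulr_suml.
  by apply: eq_bigr => i _; rewrite mxE big_ord1 mxE mulrAC.
have := @pairing_le (v^T *m w) ((sqnorm v + sqnorm w) / 2) _ t x t0.
rewrite E -/w => h.
have {}h : sqnorm w <= (sqnorm v + sqnorm w) / 2.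
  apply: le_trans (h _); first by apply: ler_sum => j _; rewrite expr2.
  move=> z; rewrite E.
  (* Row vectors act from the left, so the identity used is [B *m B^T = 1], which follows from the
     defining one for square matrices. *)
  have -> : sqnorm v = sqnorm (v *m A0 z).
    by rewrite !sqnormE trmx_mul mulmxA -(mulmxA v) (mulmx1C (A0O z)) mulmx1.
  exact: sumr_mul_mean_le.
lra.
Qed.

End MatrixHeatFlow.

Unset Implicit Arguments.

Theorem proposition3p2 (R : realType) (d n : nat) (Omega : closedManifold R d)
    (g : riemannianMetric Omega) (A0 : Omega -> 'M[R]_n)
    (A : R -> Omega -> 'M[R]_n) (hA : heat_solution g A0 A) :
  ((forall x : Omega, frobenius_norm (A0 x) = 1) ->
     (forall (t : R) (x : Omega), 0 <= t -> frobenius_norm (A t x) <= 1) /\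
     (forall (t : R) (x : Omega), 0 <= t ->
        spectral_norm (A t x) <= 1 /\ Kset (A t x))) /\
  ((forall x : Omega, orthogonal_group (A0 x)) ->
     forall (t : R) (x : Omega), 0 <= t -> `|\det (A t x)| <= 1).
Proof.
split=> [A01|A0O t x t0].
  have F1 := frobenius_norm_le1 hA A01.
  split=> [//|t x t0].
  by have S1 := spectral_norm_le1 (F1 t x t0).
by apply: norm_det_contraction => v; exact: sqnorm_flow_le hA v A0O t x t0.
Qed.
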